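(* For any $m_1,m_2\in\mathbb{N}$ with $m=\operatorname{lcm}(m_1,m_2)$ and any $a\in\mathbb{Z}$, $$\frac1m\sum_{\substack{k,\ell\ (\mathrm{mod}\ m)\\ \gcd(\ell,m)=1}}c_{m_1}(k)\,c_{m_2}(k+\ell-a)=\begin{cases}\mu(m)c_m(a), & m_1=m_2=m,\\ 0,&\text{otherwise},\end{cases}$$ where $k$ and $\ell$ run over residues modulo $m$.
   Context: For $n\in\mathbb{N}$ and $k\in\mathbb{Z}$, $c_n(k)=\sum_{1\le j\le n,\ \gcd(j,n)=1}\exp(2\pi i jk/n)$ is the Ramanujan sum. $\mu$ is the Möbius function. *)

(* Defs.v *)
From HB Require Import structures.
From mathcomp Require Import all_boot all_order all_algebra.
From mathcomp Require Import complex.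
From mathcomp Require Import reals sequences exp trigo.
Set Implicit Arguments.
Unset Strict Implicit.
Unset Printing Implicit Defensive.
Import Order.TTheory GRing.Theory Num.Theory.
Local Open Scope ring_scope.
Local Open Scope complex_scope.

Definition cexp (R : realType) (z : R[i]) : R[i] :=
  (expR (complex.Re z))%:C * (cos (complex.Im z) +i* sin (complex.Im z)).

Definition ramanujan_sum (R : realType) (n : nat) (k : int) : R[i] :=
  \sum_(1 <= j < n.+1 | coprime j n)
     cexp (2%:R * (pi : R)%:C * 'i * j%:R * k%:~R / n%:R).

Definition squarefree (n : nat) : bool :=
  (0 < n)%N && all (fun p => ~~ (p ^ 2 %| n)%N) (primes n).

Definition mobius (n : nat) : int :=
  if squarefree n then (-1) ^+ size (primes n) else 0.

(* Main.v *)
Require Import Defs.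
From HB Require Import structures.
From mathcomp Require Import all_boot all_order all_algebra.
From mathcomp Require Import complex.
From mathcomp Require Import reals sequences exp trigo.
From mathcomp Require Import ring lra.
Import Order.TTheory GRing.Theory Num.Theory.
Local Open Scope ring_scope.
Local Open Scope complex_scope.
Set Implicit Arguments.
Unset Strict Implicit.
Unset Printing Implicit Defensive.

(** The Ramanujan sum [c_n(k)] is the sum of the [k]-th powers of the primitive
    [n]-th roots of unity.  For [x] and [y] of order dividing [m], the sum over
    [k] of [x ^ (- k) * y ^ (k + b)] is [m * y ^ b] if [x = y] and [0]
    otherwise.  A primitive [m1]-th root equals a primitive [m2]-th root only
    if [m1 = m2], so, [c_m1] being even, the sum over [k] of
    [c_m1(k) * c_m2(k + b)] is [m * c_m2(b)] if [m1 = m2] and [0] otherwise.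
    With [b = l - a], summing over [l] turns each term [y ^ (l - a)] of
    [c_m(l - a)] into [y ^ (- a)] times the sum of all primitive [m]-th roots
    of unity, which is [mobius m] by Moebius inversion. *)

Section MobiusFunction.

Implicit Types n d p : nat.

Lemma mobius_sqr_dvdn p d : prime p -> (p ^ 2 %| d)%N -> mobius d = 0.
Proof.
move=> p_prime ppd; rewrite /mobius /squarefree; case: posnP => //= d_gt0.
case: allP => // /(_ p); rewrite ppd mem_primes p_prime d_gt0.
by rewrite (dvdn_trans _ ppd) ?dvdn_mulr // => /(_ isT).
Qed.

Lemma perm_primes_primeM p d : prime p -> ~~ (p %| d)%N -> (0 < d)%N ->
  perm_eq (primes (p * d)) (p :: primes d).
Proof.
move=> p_prime pNd d_gt0; apply: uniq_perm; rewrite /= ?primes_uniq //.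
  by rewrite mem_primes (negPf pNd) !andbF.
by move=> q; rewrite primesM ?(prime_gt0 p_prime) // primes_prime // !inE.
Qed.

Lemma squarefree_primeM p d : prime p -> ~~ (p %| d)%N ->
  squarefree (p * d) = squarefree d.
Proof.
move=> p_prime pNd; have p_gt0 := prime_gt0 p_prime.
rewrite /squarefree muln_gt0 p_gt0; case: posnP => //= d_gt0.
rewrite (perm_all _ (perm_primes_primeM p_prime pNd d_gt0)) /=.
rewrite expnS expn1 dvdn_pmul2l // pNd /=.
apply: eq_in_all => q; rewrite mem_primes => /and3P[q_prime _ qd].
rewrite Gauss_dvdr // coprime_pexpl // prime_coprime // dvdn_prime2 //.
by apply: contraNneq pNd => <-.
Qed.

Lemma mobius_primeM p d : prime p -> ~~ (p %| d)%N ->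
  mobius (p * d) = - mobius d.
Proof.
move=> p_prime pNd; rewrite /mobius squarefree_primeM //.
case: ifP => [/andP[d_gt0 _]|]; last by rewrite oppr0.
by rewrite (perm_size (perm_primes_primeM p_prime pNd d_gt0)) /= exprS mulN1r.
Qed.

Lemma perm_divisors_dvdn_once p n : prime p -> (0 < n)%N -> (p %| n)%N ->
  perm_eq [seq d <- divisors n | (p %| d)%N & ~~ (p ^ 2 %| d)%N]
          [seq (p * d)%N | d <- divisors n & ~~ (p %| d)%N].
Proof.
move=> p_prime n_gt0 pn; have p_gt0 := prime_gt0 p_prime.
have mulpI : injective (muln p).
  by move=> d e /eqP; rewrite eqn_pmul2l // => /eqP.
apply: uniq_perm; rewrite ?map_inj_uniq ?filter_uniq ?divisors_uniq // => d.
apply/idP/mapP => [|[e + ->]]; rewrite !mem_filter -!dvdn_divisors //.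
  case/andP=> /andP[/dvdnP[e ->]]; rewrite mulnC expnS expn1 dvdn_pmul2l //.
  move=> pNe pen; exists e => //.
  by rewrite mem_filter pNe -dvdn_divisors // (dvdn_trans _ pen) ?dvdn_mull.
case/andP=> pNe en; rewrite dvdn_mulr //= expnS expn1 dvdn_pmul2l // pNe.
by rewrite Gauss_dvd ?pn // prime_coprime.
Qed.

(* For a prime p | n, the divisors d and p * d with p not dividing d cancel
   out, and all the other divisors are multiples of p ^ 2. *)
Lemma sum_mobius_divisors n : (0 < n)%N ->
  \sum_(d <- divisors n) mobius d = (n == 1%N)%:R.
Proof.
move=> n_gt0; have [->|n_neq1] := eqVneq; first by rewrite big_seq1.
set p := pdiv n.
have p_prime : prime p by rewrite pdiv_prime // ltn_neqAle eq_sym n_neq1.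
rewrite (bigID (dvdn p)) (bigID (dvdn (p ^ 2))) /=.
rewrite big1 ?add0r => [|d /andP[_]]; last exact: mobius_sqr_dvdn.
rewrite -big_filter.
rewrite (perm_big _ (perm_divisors_dvdn_once p_prime n_gt0 (pdiv_dvd n))) /=.
rewrite big_map big_filter -big_split big1 //= => d pNd.
by rewrite mobius_primeM // addNr.
Qed.

Lemma sum_coprime_mobius (V : zmodType) (f : nat -> V) (r : seq nat) n :
    (0 < n)%N ->
  \sum_(j <- r | coprime j n) f j =
  \sum_(d <- divisors n) (\sum_(j <- r | (d %| j)%N) f j) *~ mobius d.
Proof.
move=> n_gt0; under [RHS]eq_bigr do rewrite mulrz_suml big_mkcond.
rewrite exchange_big big_mkcond /=; apply: eq_bigr => j _.
have -> : (if coprime j n then f j else 0) = f j *~ (coprime j n)%:R.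
  by case: coprime.
have gcd_gt0 : (0 < gcdn j n)%N by rewrite gcdn_gt0 n_gt0 orbT.
rewrite -(sum_mobius_divisors gcd_gt0) mulrz_sumr -big_mkcond -[RHS]big_filter.
apply/perm_big/uniq_perm => [||d]; rewrite ?filter_uniq ?divisors_uniq //.
by rewrite mem_filter -!dvdn_divisors // dvdn_gcd.
Qed.

End MobiusFunction.

Section Multiples.

Variables (V : Type) (idx : V) (op : Monoid.law idx).

Lemma big_nat_dvdn (f : nat -> V) (d e : nat) : (0 < d)%N ->
  \big[op/idx]_(0 <= j < e * d | (d %| j)%N) f j =
  \big[op/idx]_(0 <= i < e) f (i * d)%N.
Proof.
move=> d_gt0; rewrite big_mkcond big_nat_mul; apply: eq_bigr => i _.
rewrite big_ltn ?ltn_pmul2r // dvdn_mull // big_nat big1 ?Monoid.mulm1 // => j.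
move=> /andP[lt_id_j lt_j_Sid]; case: ifP => // /dvdnP[k jE].
by move: lt_id_j lt_j_Sid; rewrite jE !ltn_pmul2r // ltnS ltnNge => /negPf->.
Qed.

End Multiples.

Section RootsOfUnity.

Variable R : idomainType.
Implicit Types (x z : R) (m n d : nat).

Lemma prim_root_order_uniq z m n :
  m.-primitive_root z -> n.-primitive_root z -> m = n.
Proof.
move=> z_prim_m z_prim_n; apply/eqP; rewrite eqn_dvd.
rewrite (prim_order_dvd z_prim_m) (prim_expr_order z_prim_n).
by rewrite (prim_order_dvd z_prim_n) (prim_expr_order z_prim_m) eqxx.
Qed.

Lemma sum_expr_unity_root x n :
  x ^+ n = 1 -> \sum_(k < n) x ^+ k = n%:R *+ (x == 1).
Proof.
move=> xn1; have [->|x_neq1] := eqVneq.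
  by under eq_bigr do rewrite expr1n; rewrite sumr_const card_ord.
have /esym/eqP := subrX1 x n.
by rewrite xn1 subrr mulf_eq0 subr_eq0 (negPf x_neq1) => /eqP.
Qed.

Lemma sum_prim_root_dvdn z n d : n.-primitive_root z -> (d %| n)%N ->
  \sum_(0 <= j < n | (d %| j)%N) z ^+ j = (d == n)%:R.
Proof.
move=> z_prim /dvdnP[e nE]; have := prim_order_gt0 z_prim.
rewrite nE muln_gt0 => /andP[e_gt0 d_gt0]; rewrite big_nat_dvdn // big_mkord.
under eq_bigr do rewrite mulnC exprM.
rewrite sum_expr_unity_root; last by rewrite -exprM mulnC -nE prim_expr_order.
rewrite -(prim_order_dvd z_prim) nE -{2 3}[d]mul1n dvdn_pmul2r // eqn_pmul2r //.
by rewrite dvdn1 eq_sym; case: eqVneq => [<-|].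
Qed.

Lemma sum_prim_roots z n : n.-primitive_root z ->
  \sum_(l < n | coprime l n) z ^+ l = (mobius n)%:~R.
Proof.
move=> z_prim; have n_gt0 := prim_order_gt0 z_prim.
rewrite -(big_mkord (coprime^~ n) (fun j => z ^+ j)) sum_coprime_mobius //.
rewrite (bigD1_seq n) ?divisors_id ?divisors_uniq //=.
rewrite sum_prim_root_dvdn // eqxx big_seq_cond big1 ?addr0 // => d.
rewrite -dvdn_divisors // => /andP[dn /negPf d_neqn].
by rewrite sum_prim_root_dvdn // d_neqn mul0rz.
Qed.

End RootsOfUnity.

Lemma coprimeBl m n : (m <= n)%N -> coprime (n - m) n = coprime m n.
Proof.
by move=> le_mn; rewrite /coprime -{2 3}(subnK le_mn) gcdnDl gcdnDr gcdnC.
Qed.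

Section PrimitiveRootPowerSums.

Variable F : fieldType.
Implicit Types (x y z : F) (m n : nat) (k b : int).

Lemma sum_prim_root_eq z y m n :
    m.-primitive_root z -> n.-primitive_root y ->
  \sum_(j < m | coprime j m) (z ^+ j == y)%:R = (m == n)%:R :> F.
Proof.
move=> z_prim y_prim; have [m_eqn|m_neqn] := eqVneq; last first.
  rewrite big1 // => j j_m; case: eqP => // zjE; case/eqP: m_neqn.
  by apply: prim_root_order_uniq y_prim; rewrite -zjE prim_root_exp_coprime.
have [i yE] : {i : 'I_m | y = z ^+ i}.
  by apply: prim_rootP => //; rewrite m_eqn prim_expr_order.
have i_m : coprime i m by rewrite -(prim_root_exp_coprime _ z_prim) -yE m_eqn.
rewrite (bigD1 i) //= yE eqxx big1 ?addr0 // => j /andP[_ /negPf j_neqi].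
by rewrite (eq_prim_root_expr z_prim) !modn_small // val_eqE j_neqi.
Qed.

Definition prim_root_power_sum z n k : F :=
  \sum_(j < n | coprime j n) (z ^+ j) ^ k.

Lemma prim_root_power_sumN z n k : n.-primitive_root z ->
  prim_root_power_sum z n (- k) = prim_root_power_sum z n k.
Proof.
rewrite /prim_root_power_sum.
case: n => [|n] z_prim; first by rewrite !big_ord0.
rewrite (reindex_inj oppr_inj); apply: eq_big => /= j.
  by rewrite coprime_modl coprimeBl // ltnW.
move=> _; rewrite (prim_expr_mod z_prim) expfB // (prim_expr_order z_prim).
by rewrite div1r exprz_inv opprK.
Qed.

Lemma sum_unity_root_orthogonal x y m b : x ^+ m = 1 -> y ^+ m = 1 ->
  \sum_(k < m) x ^ (- k%:Z) * y ^ (k%:Z + b) = m%:R * y ^ b *+ (x == y).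
Proof.
case: m => [|m] xm1 ym1; first by rewrite big_ord0 mul0r mul0rn.
have [x_neq0 y_neq0] : x != 0 /\ y != 0.
  by split; [move: xm1 | move: ym1]; apply: contra_eq_neq => ->;
    rewrite expr0n eq_sym oner_neq0.
under eq_bigr do rewrite expfzDr // mulrA -exprz_inv -expfzMl -exprnP.
rewrite -mulr_suml sum_expr_unity_root; last first.
  by rewrite exprMn exprVn xm1 ym1 invr1 mulr1.
rewrite -(inj_eq (mulfI x_neq0)) mulVKf // mulr1 eq_sym.
exact: mulrnAl.
Qed.

Lemma prim_root_power_sum_orthogonal z1 z2 m1 m2 m b :
    m1.-primitive_root z1 -> m2.-primitive_root z2 ->
    (m1 %| m)%N -> (m2 %| m)%N ->
  \sum_(k < m) prim_root_power_sum z1 m1 k%:Z *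
               prim_root_power_sum z2 m2 (k%:Z + b)
  = m%:R * prim_root_power_sum z2 m2 b *+ (m1 == m2).
Proof.
move=> z1_prim z2_prim m1_m m2_m.
have unity z d j : d.-primitive_root z -> (d %| m)%N -> (z ^+ j) ^+ m = 1.
  move=> z_prim d_m; apply/eqP.
  by rewrite -exprM -(prim_order_dvd z_prim) dvdn_mull.
under eq_bigr => k _.
  rewrite -prim_root_power_sumN // /prim_root_power_sum big_distrlr /=.
  rewrite exchange_big; over.
rewrite exchange_big mulr_sumr -sumrMnl /=; apply: eq_bigr => j2 j2_m2.
rewrite exchange_big /=.
under eq_bigr => j1 _ do
  rewrite sum_unity_root_orthogonal ?(unity z1 m1) ?(unity z2 m2) // -mulr_natr.
rewrite -mulr_sumr (@sum_prim_root_eq _ _ _ m2) ?mulr_natr //.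
by rewrite prim_root_exp_coprime.
Qed.

Lemma sum_coprime_prim_root_power_sum z n b : n.-primitive_root z ->
  \sum_(l < n | coprime l n) prim_root_power_sum z n (l%:Z + b)
  = (mobius n)%:~R * prim_root_power_sum z n b.
Proof.
move=> z_prim; rewrite /prim_root_power_sum exchange_big mulr_sumr /=.
have z_neq0 : z != 0.
  by rewrite (prim_root_eq0 z_prim) -lt0n (prim_order_gt0 z_prim).
apply: eq_bigr => j j_n; rewrite -(sum_prim_roots (z := z ^+ j)); last first.
  by rewrite prim_root_exp_coprime.
by rewrite mulr_suml; apply: eq_bigr => l _; rewrite expfzDr ?expf_neq0.
Qed.

End PrimitiveRootPowerSums.

Section ComplexExponential.

Variable R : realType.
Implicit Types (x y : R[i]) (t : R) (n : nat) (k : int).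

Lemma cexp0 : cexp (0 : R[i]) = 1.
Proof. by rewrite /cexp /= expR0 cos0 sin0 mul1r. Qed.

Lemma cexpD x y : cexp (x + y) = cexp x * cexp y.
Proof.
case: x y => [a b] [c d]; rewrite /cexp /= expRD cosD sinD.
by apply/eqP; rewrite eq_complex /=; apply/andP; split; apply/eqP; ring.
Qed.

Lemma cexpN x : cexp (- x) = (cexp x)^-1.
Proof. by apply/esym/mulr1_eq; rewrite -cexpD subrr cexp0. Qed.

Lemma cexpMn x n : cexp (x * n%:R) = cexp x ^+ n.
Proof.
elim: n => [|n IHn]; first by rewrite mulr0 cexp0.
by rewrite exprSr -IHn -cexpD -natr1 mulrDr mulr1.
Qed.

Lemma cexpMz x k : cexp (x * k%:~R) = cexp x ^ k.
Proof.
case: k => n; first exact: cexpMn.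
by rewrite NegzE mulrNz mulrN cexpN cexpMn exprnN.
Qed.

Lemma cexp_imaginary t : cexp ('i * t%:C) = cos t +i* sin t.
Proof.
by rewrite /cexp /= !(mul0r, mulr0, mul1r, addr0, oppr0, add0r) expR0 mul1r.
Qed.

Lemma cexp_imaginary_neq1 t : 0 < t < pi *+ 2 -> cexp ('i * t%:C) != 1.
Proof.
move=> /andP[t_gt0 t_lt2pi].
have sin_half_gt0 : 0 < sin (t / 2).
  by apply: sin_gt0_pi; apply/andP; split; lra.
have cos_lt1 : cos t < 1.
  have -> : t = (t / 2) *+ 2 by field.
  by rewrite cos_mulr2n cos2sin2; have := exprn_gt0 2 sin_half_gt0; lra.
by rewrite cexp_imaginary eq_complex /= lt_eqF.
Qed.

Definition principal_unity_root n : R[i] :=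
  cexp (2%:R * (pi : R)%:C * 'i / n%:R).

Lemma principal_unity_rootX n i :
  principal_unity_root n ^+ i = cexp ('i * ((pi *+ 2) * (i%:R / n%:R))%:C).
Proof.
rewrite -cexpMn; congr cexp.
by rewrite !(rmorphM, rmorphMn, fmorphV, rmorph_nat) /= -mulr_natl; ring.
Qed.

Lemma principal_unity_root_primitive n : (0 < n)%N ->
  n.-primitive_root (principal_unity_root n).
Proof.
move=> n_gt0; rewrite /primitive_root_of_unity n_gt0; apply/forallP => i.
rewrite unity_rootE principal_unity_rootX; apply/eqP.
have [->|i_neqn] := eqVneq i.+1 n.
  by rewrite divff ?pnatr_eq0 -?lt0n // mulr1 cexp_imaginary cos2pi sin2pi eqxx.
have pi2_gt0 : 0 < pi *+ 2 :> R by rewrite pmulrn_lgt0 ?pi_gt0.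
apply/negbTE/cexp_imaginary_neq1; rewrite mulr_gt0 ?divr_gt0 ?ltr0n //=.
rewrite gtr_pMr // ltr_pdivrMr ?ltr0n // mul1r ltr_nat.
by rewrite ltn_neqAle i_neqn ltn_ord.
Qed.

Lemma ramanujan_sum_prim_root n k : (0 < n)%N ->
  ramanujan_sum R n k = prim_root_power_sum (principal_unity_root n) n k.
Proof.
move=> n_gt0; pose z := principal_unity_root n.
have summandE j : cexp (2%:R * pi%:C * 'i * j%:R * k%:~R / n%:R) = (z ^+ j) ^ k.
  by rewrite -cexpMn -cexpMz; congr cexp; ring.
rewrite /ramanujan_sum (eq_bigr _ (fun j _ => summandE j)) /prim_root_power_sum.
rewrite -(big_mkord (coprime^~ n) (fun j => (z ^+ j) ^ k)).
(* The index n on the left plays the role of the index 0 on the right. *)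
rewrite [LHS]big_mkcond [RHS]big_mkcond big_nat_recr //= [RHS]big_ltn //= addrC.
have z_prim := principal_unity_root_primitive n_gt0.
by rewrite /coprime gcdnn gcd0n (prim_expr_order z_prim).
Qed.

End ComplexExponential.

Theorem corollary16 (R : realType) (m1 m2 m : nat) (a : int)
    (hm1 : (0 < m1)%N) (hm2 : (0 < m2)%N) (hm : m = lcmn m1 m2) :
  (m%:R)^-1 *
    (\sum_(k < m) \sum_(l < m | coprime l m)
       ramanujan_sum R m1 k%:Z * ramanujan_sum R m2 (k%:Z + l%:Z - a))
  = if (m1 == m2) && (m2 == m) then (mobius m)%:~R * ramanujan_sum R m a
    else 0 :> R[i].
Proof.
have m_gt0 : (0 < m)%N by rewrite hm lcmn_gt0 hm1.
have m1_dvd : (m1 %| m)%N by rewrite hm dvdn_lcml.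
have m2_dvd : (m2 %| m)%N by rewrite hm dvdn_lcmr.
have z_prim := principal_unity_root_primitive R.
rewrite exchange_big /=.
under eq_bigr => l _.
  under eq_bigr do rewrite -addrA !ramanujan_sum_prim_root //.
  rewrite (prim_root_power_sum_orthogonal _ (z_prim _ hm1) (z_prim _ hm2)) //.
  over.
rewrite sumrMnl -mulr_sumr.
have [m1_eq_m2|] := eqVneq m1 m2; last by rewrite mulr0.
have m2_eq_m : m2 = m by rewrite hm m1_eq_m2; apply/esym/lcmn_idPr.
rewrite m2_eq_m eqxx mulKf ?pnatr_eq0 -?lt0n //.
by rewrite sum_coprime_prim_root_power_sum ?prim_root_power_sumN ?z_prim //
  ramanujan_sum_prim_root.
Qed.
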